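(* Let $\mathcal{R}$ be a commutative ring, $\mathbf{M}$ an $\mathcal{R}$-module, and $a,b,c,d\in\mathcal{R}$ with $a^{2}d=bc^{2}$. Then for every $(x_{n,k})_{n,k\ge0}\in\mathcal{F}^{[2]}_{\mathbf{M}}\big((a,b)\otimes(c,d)\big)$, any four consecutive diagonal terms satisfy, for all $n,k\ge0$, $$ab\,x_{n,k+3}+(a^{2}+b)c\,x_{n+1,k+2}=a(c^{2}+d)\,x_{n+2,k+1}+cd\,x_{n+3,k}.$$
   Context: $\mathcal{F}^{[2]}_{\mathbf{M}}((a,b)\otimes(c,d))$ is the set of double sequences $(x_{n,k})_{n,k\ge0}$ with $x_{n,k}\in\mathbf{M}$ such that for all $n,k\ge0$ $$x_{n+2,k}=a x_{n+1,k}+b x_{n,k},\qquad x_{n,k+2}=c x_{n,k+1}+d x_{n,k}.$$ *)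

(* Defs.v *)
From mathcomp Require Import all_boot all_algebra.

Set Implicit Arguments.
Unset Strict Implicit.
Unset Printing Implicit Defensive.

Import GRing.Theory.
Local Open Scope ring_scope.

(* Membership in F^[2]_M((a,b) (x) (c,d)).  The scalar ring may be the zero
   ring, hence [comPzRingType] rather than [comNzRingType]. *)
Definition fib2_seq (R : comPzRingType) (M : lmodType R) (a b c d : R)
    (x : nat -> nat -> M) : Prop :=
  forall n k : nat,
    x n.+2 k = a *: x n.+1 k + b *: x n k /\
    x n k.+2 = c *: x n k.+1 + d *: x n k.

(* Main.v *)
(** Both recurrences express the four diagonal terms through the entries of one
    2 x 2 block.  The coefficients of the two sides then agree identically,
    except at the corner [x n.+1 k.+1], where they are [(a ^+ 2 + b) * c ^+ 2]
    and [a ^+ 2 * (c ^+ 2 + d)]: these are equal because [a ^+ 2 * d = b * c ^+ 2]. *)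
Require Import Defs.
From mathcomp Require Import all_boot all_algebra.

Import GRing.Theory.
Local Open Scope ring_scope.

Theorem proposition4p2 (R : comPzRingType) (M : lmodType R) (a b c d : R)
    (habcd : a ^+ 2 * d = b * c ^+ 2)
    (x : nat -> nat -> M) (hx : fib2_seq a b c d x) (n k : nat) :
  (a * b) *: x n k.+3 + ((a ^+ 2 + b) * c) *: x n.+1 k.+2 =
  (a * (c ^+ 2 + d)) *: x n.+2 k.+1 + (c * d) *: x n.+3 k.
Proof.
have rec1 i j : x i.+2 j = a *: x i.+1 j + b *: x i j by case: (hx i j).
have rec2 i j : x i j.+2 = c *: x i j.+1 + d *: x i j by case: (hx i j).
(* Unfolding a recurrence twice brings an index shifted by 3 back into the block [x n k],
   [x n.+1 k], [x n k.+1], [x n.+1 k.+1]. *)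
have row3 : x n k.+3 = (c ^+ 2 + d) *: x n k.+1 + (c * d) *: x n k.
  by rewrite !rec2 scalerDr !scalerA addrAC -scalerDl expr2.
have col3 : x n.+3 k = (a ^+ 2 + b) *: x n.+1 k + (a * b) *: x n k.
  by rewrite !rec1 scalerDr !scalerA addrAC -scalerDl expr2.
(* By [habcd], both products equal [a ^+ 2 * (c ^+ 2 + d)]. *)
have corner : (a ^+ 2 + b) * c * c = a * (c ^+ 2 + d) * a.
  by rewrite -mulrA -expr2 mulrDl -habcd -mulrDr [RHS]mulrAC -expr2.
rewrite row3 col3 rec2 rec1 !scalerDr !scalerA corner.
(* Aligns the coefficients of [x n k] and [x n.+1 k], then that of [x n k.+1]. *)
rewrite [c * d * (a * b)]mulrC [c * d * _]mulrC -[_ * c * d]mulrA.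
rewrite [a * (c ^+ 2 + d) * b]mulrAC.
(* Only the order of the four summands still differs: pair the [k.+1] terms and the [k] terms. *)
by rewrite addrACA; congr (_ + _); rewrite addrC.
Qed.
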